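(* Let $2\le k\le n$. The M\''obius function $\mu$ of the lattice $\Sigma_k^n$ at $\pi\in\Sigma_k^n$ is $\mu(\pi,\hat{\mathbf{1}}_n)=a(|\pi|,n-k)$.
   Context: $\Pi_n$ denotes the set of all partitions of $\{1,\dots,n\}$ into nonempty disjoint blocks, ordered by refinement: $\pi\le\sigma$ iff every block of $\pi$ is contained in a block of $\sigma$; $|\pi|$ is the number of blocks, and $\hat{\mathbf{1}}_n$ is the one-block partition. For $2\le k\le n$, $$\Sigma_k^n:=\{\pi\in\Pi_n:\ |\pi|\geq n-k+2\ \text{ or }\ \pi=\hat{\mathbf{1}}_n\},$$ with the order induced from $\Pi_n$. Its M\''obius function is: $\mu(x,x)=1$, $\mu(x,y)=-\sum_{z\in\Sigma_k^n,\,x\le z<y}\mu(x,z)$ for $x<y$, and $\mu(x,y)=0$ otherwise. For $\ell,j\ge0$, $a(j,\ell):=\sum_{m=1}^{\ell+1}s(j,m)$, where $s(n,k)$ are the signed Stirling numbers of the first kind: $s(0,0)=1$, $s(n+1,0)=s(0,n+1)=0$ and $s(n+1,k+1)=-n\,s(n,k+1)+s(n,k)$ for $n,k\ge0$. *)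

(* Defs.v *)
From HB Require Import structures.
From mathcomp Require Import all_boot all_order all_algebra.

Set Implicit Arguments.
Unset Strict Implicit.
Unset Printing Implicit Defensive.

Import Order.TTheory GRing.Theory.
Local Open Scope ring_scope.

(** ** Moebius function of a finite poset *)

(* The recursion is on a fuel argument; [mobiusE] below states the defining
   equations and shows that the fuel [#|T|] always suffices. *)
Fixpoint mobius_rec (d : Order.disp_t) (T : finPOrderType d)
    (fuel : nat) (x y : T) : int :=
  if x == y then 1
  else if (x < y)%O then
    if fuel is fuel'.+1 then - \sum_(z : T | (x <= z < y)%O) mobius_rec fuel' x z
    else 0
  else 0.

Definition mobius (d : Order.disp_t) (T : finPOrderType d) (x y : T) : int :=
  mobius_rec #|T| x y.

Lemma mobius_rec_fuel (d : Order.disp_t) (T : finPOrderType d) (m p : nat)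
    (x y : T) :
  (#|[set z : T | (z < y)%O]| <= m)%N -> (#|[set z : T | (z < y)%O]| <= p)%N ->
  mobius_rec m x y = mobius_rec p x y.
Proof.
elim: m p y => [|m IH] [|p] y //=.
- move=> + _; rewrite leqn0 cards_eq0 => /eqP y0.
  case: eqP => // _; case: ifP => // xy.
  by have := in_set0 x; rewrite -y0 inE xy.
- move=> _; rewrite leqn0 cards_eq0 => /eqP y0.
  case: eqP => // _; case: ifP => // xy.
  by have := in_set0 x; rewrite -y0 inE xy.
move=> ym yp; case: eqP => // _; case: ifP => // xy; congr (- _).
apply: eq_bigr => z /andP[_ zy].
have lt_card : (#|[set t : T | (t < z)%O]| < #|[set t : T | (t < y)%O]|)%N.
  apply/proper_card/properP; split.
    by apply/subsetP => t; rewrite !inE => /lt_trans; apply.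
  by exists z; rewrite !inE ?ltxx.
by apply: IH; rewrite -ltnS; apply: leq_trans lt_card _.
Qed.

Lemma mobiusE (d : Order.disp_t) (T : finPOrderType d) (x y : T) :
  mobius x y =
    if x == y then 1
    else if (x < y)%O then - \sum_(z : T | (x <= z < y)%O) mobius x z
    else 0.
Proof.
rewrite /mobius (@mobius_rec_fuel _ _ #|T| #|T|.+1) ?max_card //.
exact/leqW/max_card.
Qed.

(** ** Set partitions ordered by refinement *)

(* The ground set {1, ..., n} is represented by ['I_n] = {0, ..., n - 1}. *)
Record setpart (n : nat) := SetPart {
  blocks :> {set {set 'I_n}};
  blocksP : partition blocks [set: 'I_n] }.

HB.instance Definition _ (n : nat) := [isSub for @blocks n].
HB.instance Definition _ (n : nat) := [Finite of setpart n by <:].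

Definition refines (n : nat) (pi sigma : setpart n) : bool :=
  [forall B in blocks pi, exists C in blocks sigma, B \subset C].

Lemma refinesP (n : nat) (pi sigma : setpart n) :
  reflect (forall B, B \in blocks pi -> exists2 C, C \in blocks sigma & B \subset C)
          (refines pi sigma).
Proof.
apply: (iffP forall_inP) => H B /H; first by move=> /exists_inP[C]; exists C.
by case=> C Cs BC; apply/exists_inP; exists C.
Qed.

Fact refines_refl (n : nat) : reflexive (@refines n).
Proof. by move=> pi; apply/refinesP => B piB; exists B. Qed.

Fact refines_trans (n : nat) : transitive (@refines n).
Proof.
move=> tau pi sigma /refinesP h1 /refinesP h2; apply/refinesP => B.
case/h1 => C /h2 [D sD CD] BC; exists D => //; exact: subset_trans CD.
Qed.

Fact refines_anti (n : nat) : antisymmetric (@refines n).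
Proof.
suff sub (pi sigma : setpart n) :
    refines pi sigma -> refines sigma pi -> blocks pi \subset blocks sigma.
  move=> pi sigma /andP[h1 h2]; apply: val_inj; apply/eqP.
  by rewrite eqEsubset !sub.
move=> /refinesP h1 /refinesP h2; apply/subsetP => B piB.
have /and3P[_ /trivIsetP triv n0] := blocksP pi.
have [C sC BC] := h1 B piB; have [D piD CD] := h2 C sC.
have BD : B \subset D := subset_trans BC CD.
have B0 : B != set0 by apply: contraNneq n0 => <-.
suff eqBD : B = D by have -> : B = C by apply/eqP; rewrite eqEsubset BC eqBD.
apply/eqP; apply: contraNT B0 => /(triv _ _ piB piD).
by rewrite -setI_eq0 (setIidPl BD).
Qed.

Fact setpart_display : Order.disp_t. Proof. exact: Order.Disp tt tt. Qed.

HB.instance Definition _ (n : nat) :=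
  Order.Le_isPOrder.Build setpart_display (setpart n)
    (@refines_refl n) (@refines_anti n) (@refines_trans n).

(* Removing [set0] only matters for n = 0, where the unique partition of the
   empty set has no block. *)
Definition one_block (n : nat) : {set {set 'I_n}} := [set [set: 'I_n]] :\ set0.

Fact one_blockP (n : nat) : partition (one_block n) [set: 'I_n].
Proof.
rewrite /one_block; apply/and3P; split; last by rewrite !inE eqxx.
  apply/eqP/setP => i; rewrite inE; apply/bigcupP; exists [set: 'I_n] => //.
  by rewrite !inE eqxx andbT; apply/set0Pn; exists i.
by apply: trivIsetS (subsetDl _ _) (trivIset1 _).
Qed.

Definition setpart1 (n : nat) : setpart n := SetPart (one_blockP n).

(** ** The poset Sigma_k^n *)

(* Intended for 2 <= k <= n: the subtraction is truncated. *)
Definition in_Sigma (n k : nat) : pred (setpart n) :=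
  fun pi => (n - k + 2 <= #|blocks pi|)%N || (pi == setpart1 n).

Record Sigma (n k : nat) := InSigma {
  Sigma_part :> setpart n;
  Sigma_partP : in_Sigma k Sigma_part }.

HB.instance Definition _ (n k : nat) := [isSub for @Sigma_part n k].
HB.instance Definition _ (n k : nat) := [Finite of Sigma n k by <:].
HB.instance Definition _ (n k : nat) :=
  [SubChoice_isSubPOrder of Sigma n k by <: with setpart_display].

Fact Sigma1P (n k : nat) : in_Sigma k (setpart1 n).
Proof. by rewrite /in_Sigma eqxx orbT. Qed.

Definition Sigma1 (n k : nat) : Sigma n k := InSigma (Sigma1P n k).

(** ** Signed Stirling numbers of the first kind and their partial sums *)

Fixpoint stirling1 (n k : nat) : int :=
  match n, k with
  | 0, 0 => 1
  | 0, _.+1 => 0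
  | _.+1, 0 => 0
  | n'.+1, k'.+1 => - n'%:Z * stirling1 n' k'.+1 + stirling1 n' k'
  end.

Definition stirling1_sum (j l : nat) : int :=
  \sum_(1 <= m < l.+2) stirling1 j m.

(* Main.v *)
Require Import Defs.
From mathcomp Require Import all_boot all_order all_algebra.

(** The values [mu(x, 1)] are the only solution [g] of the triangular system
    [\sum_(z >= x) g z = (x == 1)] ([mobius_dual_unique]), so it suffices to
    check that [g sigma = a(|sigma|, n - k)] solves it on [Sigma_k^n].

    The sums over the whole interval above [pi] in the partition lattice come
    from counting functions to a [q]-element set.  A function constant on the
    blocks of [pi] is the same as a function whose kernel [sigma] lies above
    [pi], and it is then an injective function on the blocks of [sigma]; hence
    [\sum_(sigma >= pi) q ^_ |sigma| = q ^ |pi|] ([sum_ffact_ge]).  Both sides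
    are polynomial in [q], and the coefficients of the falling factorial are the
    signed Stirling numbers of the first kind, so that
    [\sum_(sigma >= pi) s(|sigma|, m) = (|pi| == m)] ([sum_stirling1_ge]).
    Summing over [1 <= m <= l + 1], with [l = n - k], shows that the sum of
    [a(|sigma|, l)] over all partitions [sigma >= pi] is 1 if [|pi| <= l + 1]
    and 0 otherwise.

    The partitions left out of [Sigma_k^n] do not contribute to this sum: they
    have between 2 and [l + 1] blocks, and for such a number [j] of blocks
    [a(j, l)] is the sum of all coefficients of the falling factorial of degree
    [j], that is, its value at 1, which vanishes ([stirling1_sum_small]).
    Finally, the only member of [Sigma_k^n] with at most [l + 1] blocks is the
    one-block partition, so the sum is the required indicator. *)

Set Implicit Arguments.
Unset Strict Implicit.
Unset Printing Implicit Defensive.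

Import Order.TTheory GRing.Theory.

(** * Moebius inversion from above *)

Section Moebius.
Local Open Scope ring_scope.
Variables (d : Order.disp_t) (T : finPOrderType d).
Implicit Types x y z : T.

Lemma sum_mobius_interval x y :
  (x <= y)%O -> \sum_(z : T | (x <= z <= y)%O) mobius x z = (x == y)%:R.
Proof.
move=> xy; rewrite (bigD1 y) ?xy ?lexx //=.
have below z : ((x <= z <= y) && (z != y) = (x <= z < y))%O.
  by rewrite lt_neqAle -andbA [(z <= y)%O && _]andbC.
rewrite (eq_bigl _ _ below) mobiusE; case: eqVneq => [<-|neq_xy].
  rewrite big1 ?addr0 // => z /andP[xz zx].
  by have := le_lt_trans xz zx; rewrite ltxx.
by rewrite lt_neqAle neq_xy xy addNr.
Qed.

(** The Moebius function is defined by recursion on its second argument, while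
    the hypothesis sums over the first one.  Expanding [(z == y)] in
    [mobius x y = \sum_(z >= x) mobius x z * (z == y)] by the hypothesis and
    exchanging the two sums turns the one into the other. *)
Lemma mobius_dual_unique (y : T) (g : T -> int) :
    (forall x, \sum_(z : T | (x <= z)%O) g z = (x == y)%:R) ->
  forall x, (x <= y)%O -> mobius x y = g x.
Proof.
move=> g_sum x xy.
have -> : mobius x y =
    \sum_(z | (x <= z)%O) \sum_(w | (z <= w)%O) mobius x z * g w.
  rewrite (bigD1 y) //= [X in _ + X]big1 => [|z /andP[_ neq_zy]].
    by rewrite -big_distrr g_sum eqxx /= mulr1 addr0.
  by rewrite -big_distrr g_sum (negPf neq_zy) /= mulr0.
rewrite (exchange_big_dep (fun w => (x <= w)%O)) /=; last first.
  by move=> z w; apply: le_trans.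
rewrite (bigD1 x) //= [X in _ + X]big1 => [|w /andP[xw neq_wx]].
  by rewrite -big_distrl sum_mobius_interval //= eqxx mul1r addr0.
by rewrite -big_distrl sum_mobius_interval //= eq_sym (negPf neq_wx) mul0r.
Qed.

End Moebius.

(** * Partitions as kernels of functions *)

Section Kernels.
Variable n : nat.
Implicit Types pi sigma : setpart n.

Lemma mem_cover_setpart pi i : i \in cover pi.
Proof. by rewrite (cover_partition (blocksP pi)) inE. Qed.

Lemma trivIset_setpart pi : trivIset pi.
Proof. exact: partition_trivIset (blocksP pi). Qed.

Lemma pblock_setpart pi i : pblock pi i \in blocks pi.
Proof. by rewrite pblock_mem ?mem_cover_setpart. Qed.

Lemma setpart_block_pblock pi B :
  B \in blocks pi -> exists i, B = pblock pi i.
Proof.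
move=> piB; have [_ _ n0] := and3P (blocksP pi).
have /set0Pn[i Bi] : B != set0 by apply: contraNneq n0 => <-.
by exists i; rewrite (def_pblock (trivIset_setpart pi) piB Bi).
Qed.

Lemma le_setpartP pi sigma :
  reflect (forall i j, pblock pi i = pblock pi j ->
                       pblock sigma i = pblock sigma j)
          (pi <= sigma)%O.
Proof.
apply: (iffP (refinesP pi sigma)) => [le_pi i j eq_ij | le_pi B].
  have [C sC /subsetP piC] := le_pi _ (pblock_setpart pi i).
  have Ci : i \in C by rewrite piC ?mem_pblock ?mem_cover_setpart.
  have Cj : j \in C by rewrite piC // eq_ij mem_pblock mem_cover_setpart.
  by rewrite !(def_pblock (trivIset_setpart sigma) sC).
move=> /setpart_block_pblock[i ->]; exists (pblock sigma i).
  exact: pblock_setpart.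
apply/subsetP => j /(same_pblock (trivIset_setpart pi)) /le_pi <-.
by rewrite mem_pblock mem_cover_setpart.
Qed.

Definition kernel (rT : eqType) (F : 'I_n -> rT) : setpart n :=
  SetPart (preim_partitionP F [set: 'I_n]).

Lemma kernelP (rT : eqType) (F : 'I_n -> rT) i j :
  reflect (F i = F j) (pblock (kernel F) i == pblock (kernel F) j).
Proof.
rewrite eq_pblock ?trivIset_setpart ?mem_cover_setpart //.
rewrite pblock_equivalence_partition ?inE //; first exact: eqP.
by move=> x y z _ _ _; split=> // /eqP->.
Qed.

Variable q : nat.

Definition block_of pi i : {B | B \in blocks pi} :=
  exist _ (pblock pi i) (pblock_setpart pi i).

Lemma block_ofP pi (B : {B | B \in blocks pi}) : exists i, B = block_of pi i.
Proof.
have [i eq_B] := setpart_block_pblock (valP B).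
by exists i; apply: val_inj.
Qed.

(** [spread] identifies functions on the blocks of [pi] with the functions on
    the ground set that are constant on these blocks. *)
Definition spread pi (g : {ffun {B | B \in blocks pi} -> 'I_q}) :
    {ffun 'I_n -> 'I_q} :=
  [ffun i => g (block_of pi i)].

Lemma spread_inj pi : injective (@spread pi).
Proof.
move=> g h eq_gh; apply/ffunP => B; have [i ->] := block_ofP B.
by have := congr1 (fun F : {ffun _} => F i) eq_gh; rewrite !ffunE.
Qed.

Lemma spread_imageP pi (F : {ffun 'I_n -> 'I_q}) :
  reflect (exists g : {ffun {B | B \in blocks pi} -> 'I_q}, F = spread g)
          (pi <= kernel F)%O.
Proof.
apply: (iffP (le_setpartP _ _)) => [const_F | [g ->] i j eq_ij].
  (* Read off the value of a block at an arbitrary point of it. *)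
  have ex_i (B : {B | B \in blocks pi}) : exists i, B == block_of pi i.
    by have [i ->] := block_ofP B; exists i.
  exists [ffun B => F (xchoose (ex_i B))]; apply/ffunP => i; rewrite !ffunE.
  apply/kernelP/eqP/const_F.
  by have /eqP/(congr1 val) := xchooseP (ex_i (block_of pi i)).
apply/eqP/kernelP; rewrite !ffunE; congr (g _).
exact: val_inj.
Qed.

(** Two blocks merge in the kernel exactly when [g] takes the same value on
    them. *)
Lemma kernel_spread pi (g : {ffun {B | B \in blocks pi} -> 'I_q}) :
  (kernel (spread g) == pi) = injectiveb g.
Proof.
have le_pi : (pi <= kernel (spread g))%O by apply/spread_imageP; exists g.
rewrite eq_le le_pi andbT; apply/le_setpartP/injectiveP => [inj_g B C|inj_g i j].
  have [[i ->] [j ->]] := (block_ofP B, block_ofP C) => eq_g.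
  apply: val_inj; apply/inj_g/eqP/kernelP.
  by rewrite !ffunE.
by move/eqP/kernelP; rewrite !ffunE => /inj_g/(congr1 val).
Qed.

Lemma card_kernel_ge pi :
  #|[set F : {ffun 'I_n -> 'I_q} | (pi <= kernel F)%O]| = q ^ #|blocks pi|.
Proof.
have -> : [set F : {ffun 'I_n -> 'I_q} | (pi <= kernel F)%O] =
          @spread pi @: setT.
  apply/setP => F; rewrite inE; apply/spread_imageP/imsetP => [[g]|[g _]].
    by exists g.
  by exists g.
by rewrite card_imset ?cardsT ?card_ffun ?card_ord ?card_sig //; apply: spread_inj.
Qed.

Lemma card_kernel_eq sigma :
  #|[set F : {ffun 'I_n -> 'I_q} | kernel F == sigma]| = q ^_ #|blocks sigma|.
Proof.
have -> : [set F : {ffun 'I_n -> 'I_q} | kernel F == sigma] =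
          @spread sigma @: [set g : {ffun _ -> 'I_q} | injectiveb g].
  apply/setP => F; rewrite inE; apply/idP/imsetP => [kerF|[g]].
    have /spread_imageP[g eqF] : (sigma <= kernel F)%O by rewrite (eqP kerF).
    by exists g => //; rewrite inE -kernel_spread -eqF.
  by rewrite inE -kernel_spread => kerF ->.
rewrite card_imset ?card_inj_ffuns ?card_ord ?card_sig //; apply: spread_inj.
Qed.

(** Sort the functions that are constant on the blocks of [pi] by their
    kernel. *)
Lemma sum_ffact_ge pi :
  \sum_(sigma | (pi <= sigma)%O) q ^_ #|blocks sigma| = q ^ #|blocks pi|.
Proof.
rewrite -card_kernel_ge -sum1dep_card.
rewrite (partition_big (fun F : {ffun 'I_n -> 'I_q} => kernel F)
                       (fun sigma => (pi <= sigma)%O)) //=.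
apply: eq_bigr => sigma le_pi; rewrite -card_kernel_eq -sum1dep_card.
apply: eq_bigl => F; case: eqP => [->|]; by rewrite ?le_pi ?andbF.
Qed.

End Kernels.

(** * Stirling numbers as coefficients of falling factorials *)

Section Stirling.
Local Open Scope ring_scope.

Definition ffact_poly (j : nat) : {poly int} :=
  \prod_(i < j) ('X - (i%:R)%:P).

Lemma coef_ffact_poly j m : (ffact_poly j)`_m = stirling1 j m.
Proof.
elim: j m => [|j IHj] m; first by rewrite /ffact_poly big_ord0 coef1; case: m.
rewrite /ffact_poly big_ord_recr /= -/(ffact_poly j) mulrBr coefB coefMX coefMC.
case: m => [|m] /=; last by rewrite !IHj natz mulrC mulNr addrC.
rewrite IHj sub0r; case: j {IHj} => [|j]; by rewrite ?mulr0 ?mul0r oppr0.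
Qed.

Lemma size_ffact_poly j : size (ffact_poly j) = j.+1.
Proof. by rewrite size_prod_XsubC [index_enum _]unlock -enumT size_enum_ord. Qed.

Lemma horner_ffact_poly j (q : nat) : (ffact_poly j).[q%:R] = (q ^_ j)%:R.
Proof.
elim: j => [|j IHj]; first by rewrite /ffact_poly big_ord0 hornerC.
rewrite /ffact_poly big_ord_recr /= -/(ffact_poly j) hornerM IHj hornerXsubC.
rewrite ffactnSr natrM; case: (leqP j q) => [le_jq|lt_qj]; first by rewrite natrB.
by rewrite (ffact_small lt_qj) !mul0r.
Qed.

Lemma poly_int_eq_nat (p r : {poly int}) :
  (forall q : nat, p.[q%:R] = r.[q%:R]) -> p = r.
Proof.
move=> eq_pr; apply/eqP; rewrite -subr_eq0; apply/eqP.
pose s : seq int := [seq q%:R | q <- iota 0 (size (p - r))].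
apply: (@roots_geq_poly_eq0 _ _ s); last by rewrite size_map size_iota.
  by apply/allP => _ /mapP[q _ ->]; rewrite rootE hornerD hornerN eq_pr subrr.
by rewrite map_inj_uniq ?iota_uniq // => a b; rewrite !natz => -[].
Qed.

Lemma sum_ffact_poly_ge n (pi : setpart n) :
  \sum_(sigma : setpart n | (pi <= sigma)%O) ffact_poly #|blocks sigma| =
    'X^#|blocks pi|.
Proof.
apply: poly_int_eq_nat => q; rewrite horner_sum hornerXn -natrX -sum_ffact_ge.
by rewrite natr_sum; apply: eq_bigr => sigma _; rewrite horner_ffact_poly.
Qed.

(** This is the classical inversion between the two kinds of Stirling numbers:
    the number of [sigma >= pi] with [i] blocks is the Stirling number of the
    second kind of [|pi|] and [i]. *)
Lemma sum_stirling1_ge n (pi : setpart n) m :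
  \sum_(sigma : setpart n | (pi <= sigma)%O) stirling1 #|blocks sigma| m =
    (#|blocks pi| == m)%:R.
Proof.
rewrite eq_sym -coefXn -sum_ffact_poly_ge coef_sum.
by apply: eq_bigr => sigma _; rewrite coef_ffact_poly.
Qed.

Lemma sum_stirling1_sum_ge n (pi : setpart n) l :
  \sum_(sigma : setpart n | (pi <= sigma)%O) stirling1_sum #|blocks sigma| l =
    (1 <= #|blocks pi| <= l.+1)%N%:R.
Proof.
rewrite /stirling1_sum exchange_big /= (eq_bigr _ (fun m _ => sum_stirling1_ge pi m)).
case: (boolP (1 <= _ <= _)%N) => [/andP[pi_gt0 pi_le] | out].
  rewrite (bigD1_seq #|blocks pi|) ?mem_index_iota ?pi_gt0 ?iota_uniq //=.
  by rewrite eqxx big1 ?addr0 // => m /negPf; rewrite eq_sym => ->.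
rewrite big_nat_cond big1 // => m /andP[m_in _].
by case: eqP => // eq_m; rewrite eq_m -ltnS m_in in out.
Qed.

(** Once [j <= l + 1] no coefficient of the falling factorial is cut off, so the
    partial sum is its value at 1, and 1 is a root as soon as [2 <= j]. *)
Lemma stirling1_sum_small j l :
  (2 <= j <= l.+1)%N -> stirling1_sum j l = 0.
Proof.
case/andP=> j_ge2 j_le.
have := horner_ffact_poly j 1; rewrite ffact_small //.
rewrite (@horner_coef_wide _ l.+2) ?size_ffact_poly //.
rewrite -(big_mkord xpredT (fun m => (ffact_poly j)`_m * 1%:R ^+ m)).
rewrite big_nat_recl // coef_ffact_poly; case: j j_ge2 {j_le} => // j _.
rewrite mul0r add0r => sum0; apply: etrans sum0.
rewrite /stirling1_sum big_add1 /=; apply: eq_bigr => m _.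
by rewrite expr1n mulr1 coef_ffact_poly.
Qed.

End Stirling.

(** * The poset of partitions with many blocks *)

Lemma card_setpart_gt0 n (pi : setpart n) : 0 < n -> 0 < #|blocks pi|.
Proof.
by case: n pi => // n pi _; apply/card_gt0P; exists (pblock pi ord0);
   apply: pblock_setpart.
Qed.

Lemma blocks_setpart1 n : 0 < n -> blocks (setpart1 n) = [set [set: 'I_n]].
Proof.
case: n => // n _; apply/setP => B; rewrite !inE andbC.
by case: eqP => // ->; apply/set0Pn; exists ord0; rewrite inE.
Qed.

Lemma card_setpart_eq1 n (pi : setpart n) :
  0 < n -> (#|blocks pi| == 1) = (pi == setpart1 n).
Proof.
move=> n_gt0; apply/cards1P/eqP => [[B eqB]|->]; last first.
  by exists [set: 'I_n]; apply: blocks_setpart1.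
apply: val_inj; apply: etrans (esym (blocks_setpart1 n_gt0)); rewrite /= eqB.
by rewrite -(cover_partition (blocksP pi)) eqB /cover big_set1.
Qed.

Lemma le_setpart1 n (pi : setpart n) : 0 < n -> (pi <= setpart1 n)%O.
Proof.
move=> n_gt0; apply/refinesP => B _.
by exists [set: 'I_n]; rewrite ?subsetT // blocks_setpart1 ?inE.
Qed.

(** The sum extends to all partitions above [pi] because the additional terms
    vanish by [stirling1_sum_small]. *)
Lemma sum_stirling1_sum_Sigma n k (pi : Sigma n k) :
    0 < n ->
  (\sum_(sigma : Sigma n k | (pi <= sigma)%O)
     stirling1_sum #|blocks sigma| (n - k) = (pi == Sigma1 n k)%:R)%R.
Proof.
move=> n_gt0.
have -> : (pi == Sigma1 n k) = (1 <= #|blocks pi| <= (n - k).+1).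
  rewrite card_setpart_gt0 //= -[pi == _]/(Sigma_part pi == setpart1 n).
  have := Sigma_partP pi; rewrite /in_Sigma addn2.
  case: eqP => [->|_]; last by rewrite orbF; case: ltngtP.
  by rewrite blocks_setpart1 // cards1.
rewrite -sum_stirling1_sum_ge.
rewrite [RHS](bigID (in_Sigma k)) /= [X in (_ + X)%R]big1 ?addr0.
  rewrite [RHS](reindex_omap (@Sigma_part n k) insub) => [|sigma /andP[_ sS]].
    by apply: eq_bigl => sigma; rewrite (valP sigma) valK eqxx !andbT.
  by rewrite (insubT _ sS).
move=> sigma /andP[_]; rewrite negb_or addn2 -ltnNge ltnS -card_setpart_eq1 //.
case/andP=> le_s neq1; apply: stirling1_sum_small.
by rewrite le_s andbT ltn_neqAle eq_sym neq1 card_setpart_gt0.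
Qed.

Theorem theorem5p2 (n k : nat) (hk : 2 <= k) (hkn : k <= n) (pi : Sigma n k) :
  mobius pi (Sigma1 n k) = stirling1_sum #|blocks pi| (n - k).
Proof.
have n_gt0 : 0 < n by apply: leq_trans hkn; apply: leq_trans hk.
pose g (sigma : Sigma n k) := stirling1_sum #|blocks sigma| (n - k).
apply: (@mobius_dual_unique _ _ (Sigma1 n k) g) => [sigma|].
  exact: sum_stirling1_sum_Sigma.
exact: le_setpart1.
Qed.
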